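(* Let $k\ge2$. With $\tilde{\mathcal E}_{k,i}(N)$ ($0<i\le k$) and $\tilde\Gamma_{k,i}(N)$ ($0\le i<k$) as defined below, for all $N\ge0$: $$\tilde{\mathcal{E}}_{k,i}(N) = (ab)^N (-1/a,-1/b;q)_N q^N \sum_{n=-N}^N (-1)^n\frac{q^{kn^2+(k-i-1)n - 2\binom{n}{2}}}{(q;q)_{N-n}(q;q)_{N+n}},\qquad \tilde{\Gamma}_{k,i}(N) = (ab)^N (-1/a,-1/b;q)_N \sum_{n=-N}^{N-1} (-1)^n\frac{q^{kn^2+(k-i-2)n - 2\binom{n}{2}}}{(q;q)_{N-n-1}(q;q)_{N+n}}.$$
   Context: $(a;q)_n=\prod_{j=0}^{n-1}(1-aq^j)$, $(a,b;q)_n=(a;q)_n(b;q)_n$. Generalized Bressoud–Burge lattice paths: paths in the first quadrant starting on the $y$-axis and ending on the $x$-axis, with steps NE $(x,y)\to(x+1,y+1)$, SE $(x,y)\to(x+1,y-1)$, S $(x,y)\to(x,y-1)$, SW $(x,y)\to(x-1,y-1)$, E $(x,0)\to(x+1,0)$ (only at height 0), where S and SW steps may only occur immediately after an NE step (the path ends at its first arrival on the $x$-axis after its last peak, or at its first arrival on the $x$-axis if it has no peak). A peak is a vertex preceded by NE and followed by S (labelled $a$ or $b$: $a$-peak or $b$-peak), by SW ($ab$-peak), or by SE ($1$-peak). Marked by $a$: $a$- and $ab$-peaks; marked by $b$: $b$- and $ab$-peaks. Major index: sum of the $x$-coordinates of the peaks. Even $(k,i)$-conditions: the path starts at $(0,k-i)$,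 its height is always $<k$, and for each peak with coordinates $(x,k-1)$, $x-u+v\equiv i-1\pmod 2$, where $u$ (resp. $v$) is the number of $a$-peaks (resp. $b$-peaks) before that peak. $\tilde{\mathcal E}_{k,i}(N)=\sum a^sb^tq^n$ over paths with exactly $N$ peaks satisfying the even $(k,i)$-conditions ($s,t,n$: numbers of peaks marked by $a$, by $b$, and major index); $\tilde\Gamma_{k,i}(N)$ is the same kind of generating function for the objects obtained from the paths counted by $\tilde{\mathcal E}_{k,i+1}(N)$ that begin with an NE step, by deleting this step and shifting the rest one unit to the left. *)

(* Defs.v *)
From HB Require Import structures.
From mathcomp Require Import all_boot all_order all_algebra.
From mathcomp Require Import all_classical.
From mathcomp Require Import zify.

Set Implicit Arguments.
Unset Strict Implicit.
Unset Printing Implicit Defensive.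

Import Order.TTheory GRing.Theory Num.Theory.
Local Open Scope ring_scope.
Local Open Scope classical_set_scope.

Record fps (R : Type) := Fps { fps_coef : nat -> R }.

HB.instance Definition _ (R : Type) := gen_eqMixin (fps R).
HB.instance Definition _ (R : Type) := gen_choiceMixin (fps R).

Lemma fpsP (R : Type) (f g : fps R) : fps_coef f =1 fps_coef g -> f = g.
Proof. by case: f g => [f] [g] /= fg; congr Fps; apply/funext. Qed.

Section FpsRing.
Variable R : comNzRingType.
Implicit Types f g h : fps R.

Definition fps_zero : fps R := Fps (fun=> 0).
Definition fps_opp f := Fps (fun n => - fps_coef f n).
Definition fps_add f g := Fps (fun n => fps_coef f n + fps_coef g n).

Fact fps_addA : associative fps_add.
Proof. by move=> f g h; apply: fpsP => n /=; rewrite addrA. Qed.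
Fact fps_addC : commutative fps_add.
Proof. by move=> f g; apply: fpsP => n /=; rewrite addrC. Qed.
Fact fps_add0 : left_id fps_zero fps_add.
Proof. by move=> f; apply: fpsP => n /=; rewrite add0r. Qed.
Fact fps_addN : left_inverse fps_zero fps_opp fps_add.
Proof. by move=> f; apply: fpsP => n /=; rewrite addNr. Qed.

HB.instance Definition _ :=
  GRing.isZmodule.Build (fps R) fps_addA fps_addC fps_add0 fps_addN.

Definition fpsC (c : R) : fps R := Fps (fun n => if n == 0%N then c else 0).
Definition fpsX : fps R := Fps (fun n => (n == 1%N)%:R).

Definition fps_mul f g :=
  Fps (fun n => \sum_(j < n.+1) fps_coef f j * fps_coef g (n - j)%N).

Let trunc n f : {poly R} := \poly_(j < n.+1) fps_coef f j.

Let truncE n f j : (j <= n)%N -> (trunc n f)`_j = fps_coef f j.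
Proof. by move=> jn; rewrite coef_poly ltnS jn. Qed.

Let fps_mulE m n f g :
  (n <= m)%N -> fps_coef (fps_mul f g) n = (trunc m f * trunc m g)`_n.
Proof.
move=> nm; rewrite coefM /=; apply: eq_bigr => j _.
by have := ltn_ord j => jn; rewrite !truncE //; lia.
Qed.

Fact fps_mulA : associative fps_mul.
Proof.
move=> f g h; apply: fpsP => n.
transitivity ((trunc n f * (trunc n g * trunc n h))`_n).
  rewrite coefM; apply: eq_bigr => j _; have := ltn_ord j => jn.
  by rewrite truncE ?(fps_mulE (m := n)) //; lia.
rewrite mulrA coefM; apply: eq_bigr => j _; have := ltn_ord j => jn.
by rewrite truncE ?(fps_mulE (m := n)) //; lia.
Qed.

Fact fps_mulC : commutative fps_mul.
Proof.
by move=> f g; apply: fpsP => n; rewrite !(fps_mulE (m := n)) // mulrC.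
Qed.

Fact fps_mul1 : left_id (fpsC 1) fps_mul.
Proof.
move=> f; apply: fpsP => n /=; rewrite big_ord_recl /= mul1r subn0.
by rewrite big1 ?addr0 // => j _; rewrite mul0r.
Qed.

Fact fps_mulD : left_distributive fps_mul +%R.
Proof.
move=> f g h; apply: fpsP => n /=; rewrite -big_split /=.
by apply: eq_bigr => j _; rewrite mulrDl.
Qed.

Fact fps_one_neq0 : fpsC 1 != 0.
Proof.
by apply/eqP => /(congr1 (fun f => fps_coef f 0)) /=; apply/eqP/oner_neq0.
Qed.

HB.instance Definition _ := GRing.Zmodule_isComNzRing.Build (fps R)
  fps_mulA fps_mulC fps_mul1 fps_mulD fps_one_neq0.

End FpsRing.

Arguments fpsX {R}.

Section FpsUnitRing.
Variable R : comUnitRingType.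
Implicit Types f g : fps R.

Definition fps_unit : {pred fps R} :=
  fun f => fps_coef f 0 \is a GRing.unit.

(* The first n coefficients of the inverse of f. *)
Fixpoint fps_inv_seq f n : seq R :=
  if n is m.+1 then
    let s := fps_inv_seq f m in
    rcons s ((fps_coef f 0)^-1 *
      ((m == 0%N)%:R - \sum_(j < m) fps_coef f (m - j)%N * s`_j))
  else [::].

Definition fps_inv f : fps R :=
  if f \in fps_unit then Fps (fun n => (fps_inv_seq f n.+1)`_n) else f.

Let size_inv_seq f n : size (fps_inv_seq f n) = n.
Proof. by elim: n => //= n IHn; rewrite size_rcons IHn. Qed.

Let nth_inv_seq f n j :
  (j < n)%N -> (fps_inv_seq f n)`_j = (fps_inv_seq f j.+1)`_j.
Proof.
elim: n => // n IHn; rewrite ltnS leq_eqVlt => /orP[/eqP -> //|jn].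
by rewrite [LHS]/= nth_rcons size_inv_seq jn IHn.
Qed.

Fact fps_mulV : {in fps_unit, left_inverse (1 : fps R) fps_inv *%R}.
Proof.
move=> f Uf; apply: fpsP => n; rewrite /fps_inv Uf.
rewrite [LHS]/= big_ord_recr /= subnn nth_rcons size_inv_seq ltnn eqxx.
rewrite [_ * fps_coef f 0]mulrC mulVKr //.
rewrite [X in X + _](_ : _ =
    \sum_(j < n) fps_coef f (n - j)%N * (fps_inv_seq f n)`_j); last first.
  apply: eq_bigr => j _; rewrite mulrC; congr (_ * _).
  by rewrite (nth_inv_seq f (ltn_ord j)).
by rewrite addrC subrK; case: n.
Qed.

Fact fps_unitPl f g : g * f = 1 -> fps_unit f.
Proof.
move=> /(congr1 (fun h => fps_coef h 0)) /=.
rewrite big_ord_recl big_ord0 addr0 /= => gf.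
by apply/unitrPr; exists (fps_coef g 0); rewrite mulrC.
Qed.

Fact fps_inv_out : {in [predC fps_unit], fps_inv =1 id}.
Proof. by move=> f; rewrite inE /fps_inv => /negbTE ->. Qed.

HB.instance Definition _ := GRing.ComNzRing_hasMulInverse.Build (fps R)
  fps_mulV fps_unitPl fps_inv_out.

End FpsUnitRing.

Definition qpoch (A : pzRingType) (x q : A) (n : nat) : A :=
  \prod_(j < n) (1 - x * q ^+ j).

(* The integers m, m + 1, ..., M, in this order; empty when M < m. *)
Definition zrange (m M : int) : seq int :=
  if m <= M then [seq m + j%:Z | j <- iota 0 (absz (M - m)).+1] else [::].

Definition binz2 (n : int) : int := (n * (n - 1) %/ 2)%Z.

(* A path is given by its starting vertex and its sequence of steps. The two
   S steps carry the label of the peak that they follow. *)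
Inductive step := stepNE | stepSE | stepSa | stepSb | stepSW | stepE.

Definition step_code (s : step) : 'I_6 :=
  match s with
  | stepNE => @Ordinal 6 0 isT
  | stepSE => @Ordinal 6 1 isT
  | stepSa => @Ordinal 6 2 isT
  | stepSb => @Ordinal 6 3 isT
  | stepSW => @Ordinal 6 4 isT
  | stepE => @Ordinal 6 5 isT
  end.
Definition step_decode (n : 'I_6) : step :=
  nth stepE [:: stepNE; stepSE; stepSa; stepSb; stepSW] n.
Fact step_codeK : cancel step_code step_decode.
Proof. by case. Qed.
HB.instance Definition _ := Finite.copy step (can_type step_codeK).

Definition vertex : Type := int * int.

Definition move (v : vertex) (s : step) : vertex :=
  match s with
  | stepNE => (v.1 + 1, v.2 + 1)
  | stepSE => (v.1 + 1, v.2 - 1)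
  | stepSa | stepSb => (v.1, v.2 - 1)
  | stepSW => (v.1 - 1, v.2 - 1)
  | stepE => (v.1 + 1, v.2)
  end.

Definition vertices (v : vertex) (p : seq step) : seq vertex :=
  v :: scanl move v p.

(* In [legal] and [peaks], [ne] tells whether v is reached by an NE step. *)
Fixpoint legal (ne : bool) (v : vertex) (p : seq step) : bool :=
  if p is s :: p' then
    match s with
    | stepNE | stepSE => true
    | stepSa | stepSb | stepSW => ne
    | stepE => v.2 == 0
    end && legal (s == stepNE) (move v s) p'
  else true.

(* A peak is recorded with the step that follows it: SE for a 1-peak, Sa for
   an a-peak, Sb for a b-peak and SW for an ab-peak. *)
Definition peak : Type := vertex * step.

Fixpoint peaks (ne : bool) (v : vertex) (p : seq step) : seq peak :=
  if p is s :: p' then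
    let P := peaks (s == stepNE) (move v s) p' in
    if ne && (s \in [:: stepSE; stepSa; stepSb; stepSW])
    then (v, s) :: P else P
  else [::].

(* The path ends on the x-axis, and each earlier vertex on the x-axis is
   followed by a peak. (A vertex on the x-axis is not itself a peak.) *)
Fixpoint ends_on_axis (v : vertex) (p : seq step) : bool :=
  if p is s :: p' then
    ((v.2 == 0) ==> (peaks false v p != [::])) && ends_on_axis (move v s) p'
  else v.2 == 0.

Definition bb_path (v : vertex) (p : seq step) : bool :=
  [&& v.1 == 0, legal false v p,
      all (fun w : vertex => (0 <= w.1) && (0 <= w.2)) (vertices v p)
    & ends_on_axis v p].

Definition apeak (x : peak) : bool := x.2 == stepSa.
Definition bpeak (x : peak) : bool := x.2 == stepSb.
Definition marked_a (x : peak) : bool := x.2 \in [:: stepSa; stepSW].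
Definition marked_b (x : peak) : bool := x.2 \in [:: stepSb; stepSW].

Definition major (P : seq peak) : int := \sum_(x <- P) x.1.1.

Definition even_start (k i : nat) : vertex := (0, k%:Z - i%:Z).

Definition even_path (k i : nat) (p : seq step) : Prop :=
  let v := even_start k i in
  [/\ bb_path v p,
      all (fun w : vertex => w.2 < k%:Z) (vertices v p)
    & forall (P P' : seq peak) (x : peak),
        peaks false v p = P ++ x :: P' -> x.1.2 = k%:Z - 1 ->
        (x.1.1 - (count apeak P)%:Z + (count bpeak P)%:Z
           = i%:Z - 1 %[mod 2])%Z].

(* The sum of a^s b^t q^n over the objects p in A with N peaks, where pk p is
   the sequence of the peaks of p. The sum over p is a finitely supported sum,
   which is 0 by convention on an infinite support; the index set is finite in
   both uses below, by [finite_even_path] and [finite_gamma_path]. *)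
Definition peak_gf (R : comUnitRingType) (a b : R)
    (pk : seq step -> seq peak) (A : set (seq step)) (N : nat) : fps R :=
  Fps (fun n => \sum_(p \in [set p | [/\ A p, size (pk p) = N
                                        & major (pk p) = n%:Z]])
    a ^+ count marked_a (pk p) * b ^+ count marked_b (pk p)).

Definition E_gf (R : comUnitRingType) (a b : R) (k i N : nat) : fps R :=
  peak_gf a b (peaks false (even_start k i)) [set p | even_path k i p] N.

(* Deleting the initial NE step of a path that starts at (0, k - (i + 1)) and
   shifting the rest one unit to the left gives an object that starts at
   (0, k - i). Its initial vertex is regarded as reached by an NE step, so that
   its peaks are the shifted peaks of the original path. *)
Definition Gamma_gf (R : comUnitRingType) (a b : R) (k i N : nat) : fps R :=
  peak_gf a b (peaks true (even_start k i))
    [set p | even_path k i.+1 (stepNE :: p)] N.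

Lemma no_peak_after_NE (v : vertex) (p : seq step) :
  peaks true v p = [::] -> 0 < v.2 -> legal true v p -> ~~ ends_on_axis v p.
Proof.
elim: p v => [|s p IHp] v /=; first by move=> _; case: ltgtP.
case: s => //= P0 v0 H; last by case/andP: H => /eqP H; rewrite H in v0.
by rewrite negb_and (IHp _ P0) ?orbT //=; lia.
Qed.

Lemma no_peak_size (v : vertex) (p : seq step) :
    peaks false v p = [::] -> legal false v p ->
    all (fun w : vertex => (0 <= w.1) && (0 <= w.2)) (vertices v p) ->
  ends_on_axis v p -> (size p)%:Z = v.2.
Proof.
elim: p v => [|s p IHp] v; first by move=> _ _ _ /eqP ->.
move=> /= P0 /andP[Ls L] /and3P[/andP[v1 v2] w0 ws] /andP[E1 E2].
rewrite P0 implybF in E1.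
case: s P0 Ls L w0 ws E2 => //= P0 Ls L w0 ws E2.
- by have /negP[] := no_peak_after_NE P0 ltac:(rewrite /=; lia) L.
- have := IHp _ P0 L; rewrite /= w0 => /(_ ws E2); lia.
- by rewrite Ls in E1.
Qed.

Lemma peak_size (X K : int) (ne : bool) (v : vertex) (p : seq step) :
    peaks ne v p != [::] -> legal ne v p ->
    all (fun w : vertex => (0 <= w.1) && (0 <= w.2)) (vertices v p) ->
    all (fun w : vertex => w.2 < K) (vertices v p) ->
    all (fun x : peak => x.1.1 <= X) (peaks ne v p) ->
  ends_on_axis v p -> (size p)%:Z <= X + K - v.1 + 3 * (size (peaks ne v p))%:Z.
Proof.
elim: p ne v => [|s p IHp] ne v //=.
move=> + /andP[Ls L] /and3P[_ w0 ws] /and3P[vK k0 ks] + /andP[_ E2].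
have {}IHp := IHp (s == stepNE) (move v s) _ L.
rewrite /= w0 k0 in IHp.
have Q := @no_peak_size (move v s) p.
rewrite /= w0 in Q.
case: ifP => [/andP[_ sP] _ /= /andP[vX aX]|sP Pn aX].
  have sE : (s == stepNE) = false by case: s sP {Ls L w0 ws k0 ks aX E2 IHp Q}.
  rewrite sE in L aX IHp *.
  case: (altP (peaks false (move v s) p =P [::])) => [P0|Pn].
    have := Q P0 L ws E2; rewrite P0.
    move: w0 k0 => /andP[_ w0] k0 /=; lia.
  have := IHp Pn ws ks aX E2.
  by case: s sP {Ls L w0 ws k0 ks aX E2 IHp Q sE Pn} => //= _; lia.
have := IHp Pn ws ks aX E2.
case: s sP Ls {L w0 ws k0 ks aX E2 IHp Q Pn} => //=; case: ne => //=; lia.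
Qed.

Lemma all_peaks (Q : pred vertex) (ne : bool) (v : vertex) (p : seq step) :
  all Q (vertices v p) -> all (fun x : peak => Q x.1) (peaks ne v p).
Proof.
elim: p ne v => //= s p IHp ne v /and3P[Qv Qw Qs].
by case: ifP => _ /=; rewrite ?Qv IHp //= Qw.
Qed.

Lemma le_major (P : seq peak) :
    all (fun x : peak => 0 <= x.1.1) P ->
  0 <= major P /\ all (fun x : peak => x.1.1 <= major P) P.
Proof.
rewrite /major; elim: P => [|x P IHP] /=; first by rewrite big_nil.
case/andP=> x0 /IHP[]; rewrite big_cons; set M := \sum_(y <- P) _ => M0 leP.
split; first by lia.
apply/andP; split; first by lia.
by apply: sub_all leP => y yM; lia.
Qed.

Lemma even_path_size (k i : nat) (p : seq step) :
    even_path k i p ->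
  (size p)%:Z <= major (peaks false (even_start k i) p) + k%:Z
                 + 3 * (size (peaks false (even_start k i) p))%:Z.
Proof.
set v := even_start k i => -[/and4P[_ L W E] K _].
have W1 : all (fun w : vertex => 0 <= w.1) (vertices v p).
  by apply: sub_all W => w /andP[].
have [M0 MP] := le_major (all_peaks false W1).
case: (altP (peaks false v p =P [::])) => [P0|Pn].
  have -> := no_peak_size P0 L W E; rewrite P0 /major big_nil /=; lia.
have := peak_size Pn L W K MP E; rewrite /=; lia.
Qed.

Lemma peaks_shift (ne : bool) (x y : int) (p : seq step) :
  peaks ne (x + 1, y) p =
  [seq ((w.1.1 + 1, w.1.2), w.2) | w <- peaks ne (x, y) p].
Proof.
elim: p ne x y => //= s p IHp ne x y.
have -> : move (x + 1, y) s = ((move (x, y) s).1 + 1, (move (x, y) s).2).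
  by case: s => //=; congr pair; lia.
by rewrite IHp -surjective_pairing; case: ifP.
Qed.

Lemma finite_size_le (B : nat) : finite_set [set p : seq step | (size p <= B)%N].
Proof.
pose F m : set (seq step) := range (fun t : m.-tuple step => tval t).
apply: (sub_finite_set (B := \bigcup_(m in `I_B.+1) F m)).
  by move=> p /= pB; exists (size p) => //; exists (in_tuple p).
apply: bigcup_finite => [|m _]; first exact: finite_II.
exact: finite_image.
Qed.

Lemma finite_even_path (k i N n : nat) :
  finite_set [set p | [/\ even_path k i p,
                         size (peaks false (even_start k i) p) = N
                       & major (peaks false (even_start k i) p) = n%:Z]].
Proof.
apply: sub_finite_set (finite_size_le (n + k + 3 * N)) => p /= [pP pN pn].
by have := even_path_size pP; rewrite pN pn; lia.
Qed.

Lemma finite_gamma_path (k i N n : nat) :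
  finite_set [set p | [/\ even_path k i.+1 (stepNE :: p),
                         size (peaks true (even_start k i) p) = N
                       & major (peaks true (even_start k i) p) = n%:Z]].
Proof.
apply: sub_finite_set (finite_size_le (n + k + 4 * N)) => p /= [pP pN pn].
have := even_path_size pP.
have -> : peaks false (even_start k i.+1) (stepNE :: p) =
    peaks true (0 + 1, k%:Z - i%:Z) p.
  by rewrite /= /even_start /=; congr (peaks _ (_, _) _); lia.
rewrite peaks_shift size_map pN /major big_map big_split /= -/(major _) pn.
rewrite (_ : \sum_(j <- _) 1 = N%:Z); first by lia.
by rewrite big_const_seq count_predT pN iter_addr addr0 natz.
Qed.

(* Main.v *)
Require Import Defs.
From HB Require Import structures.
From mathcomp Require Import all_boot all_order all_algebra.
From mathcomp Require Import all_classical.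
From mathcomp Require Import zify ring.

(* Along a path x - u + v + y changes parity only at E steps, so the parity
   condition says that an even number of E steps precedes each peak of height
   k - 1. Splitting off the first step gives recurrences between E_{k,i}(N) and
   Gamma_{k,i}(N); the paths that start with an E step (i = k) are counted by
   E_{k,k-1}(N). The two sums satisfy the same recurrences, by
   (1 - q^m) / (q)_m = 1 / (q)_{m-1} in each term and by the symmetries
   n -> -n and n -> -1 - n. The recurrences have a unique solution because
   1 - q^{2N} is invertible. *)

Set Implicit Arguments.
Unset Strict Implicit.
Unset Printing Implicit Defensive.

Import Order.TTheory GRing.Theory Num.Theory.
Local Open Scope ring_scope.
Local Open Scope classical_set_scope.

(** * Paths and the parity of E steps *)

Definition peak_step (ne : bool) (s : step) : bool :=
  ne && (s \in [:: stepSE; stepSa; stepSb; stepSW]).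

Definition dx (s : step) : int := (move (0, 0) s).1.
Definition dy (s : step) : int := (move (0, 0) s).2.

Lemma moveE (v : vertex) (s : step) : move v s = (v.1 + dx s, v.2 + dy s).
Proof. by case: v s => x y [] /=; congr pair; rewrite ?addr0 ?add0r. Qed.

(** Lets every recurrence restart the rest of a path at abscissa 0; the translation is then seen
    only by the major index. *)
Lemma peaks_translate (d : int) (ne : bool) (x y : int) (p : seq step) :
  peaks ne (x + d, y) p =
  [seq ((w.1.1 + d, w.1.2), w.2) | w <- peaks ne (x, y) p].
Proof.
elim: p ne x y => //= s p IHp ne x y.
by rewrite !moveE /= addrAC IHp; case: ifP.
Qed.

Lemma peaks_cons (ne : bool) (y : int) (s : step) (p : seq step) :
  peaks ne (0, y) (s :: p) =
  (if peak_step ne s then [:: ((0, y), s)] else [::]) ++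
  [seq ((w.1.1 + dx s, w.1.2), w.2) | w <- peaks (s == stepNE) (0, y + dy s) p].
Proof. by rewrite -peaks_translate [LHS]/= !moveE /peak_step; case: ifP. Qed.

Lemma major_translate (d : int) (P : seq peak) :
  major [seq ((w.1.1 + d, w.1.2), w.2) | w <- P] = major P + d * (size P)%:Z.
Proof.
rewrite /major big_map big_split /=; congr (_ + _).
by rewrite big_const_seq count_predT iter_addr addr0 -mulr_natr natz.
Qed.

Lemma size_peaks_cons (ne : bool) (y : int) (s : step) (p : seq step) :
  size (peaks ne (0, y) (s :: p)) =
  (peak_step ne s + size (peaks (s == stepNE) ((0, y + dy s)%R) p))%N.
Proof. by rewrite peaks_cons size_cat size_map; case: peak_step. Qed.

Lemma major_peaks_cons (ne : bool) (y : int) (s : step) (p : seq step) :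
  major (peaks ne (0, y) (s :: p)) =
  major (peaks (s == stepNE) (0, y + dy s) p) +
  dx s * (size (peaks (s == stepNE) (0, y + dy s) p))%:Z.
Proof.
rewrite peaks_cons -major_translate /major big_cat /=.
by case: peak_step; rewrite ?big_seq1 ?big_nil add0r.
Qed.

Lemma has_peak_translate (x y : int) (ne : bool) (p : seq step) :
  (peaks ne (x, y) p == [::]) = (peaks ne (0, y) p == [::]).
Proof. by rewrite -[x]add0r peaks_translate -!size_eq0 size_map. Qed.

Definition legal_step (ne : bool) (y : int) (s : step) : bool :=
  match s with
  | stepNE | stepSE => true
  | stepSa | stepSb | stepSW => ne
  | stepE => y == 0
  end.

(* In [good k e ne y p], [y] is the height of the starting vertex and [e] tells
   whether the number of E steps made before it is odd. *)
Fixpoint good (k : nat) (e ne : bool) (y : int) (p : seq step) : bool :=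
  [&& 0 <= y, y < k%:Z &
    if p is s :: p' then
      [&& legal_step ne y s,
          (y == 0) ==> (peaks false (0, y) p != [::]),
          ~~ [&& peak_step ne s, y == k%:Z - 1 & e]
        & good k (e (+) (s == stepE)) (s == stepNE) (y + dy s) p']
    else y == 0].

(** The parity clause of [even_path] with a free residue [c], which changes when a peak is split
    off. *)
Definition peak_parity (k : nat) (c : int) (P : seq peak) : Prop :=
  forall (P1 P2 : seq peak) (x : peak),
    P = P1 ++ x :: P2 -> x.1.2 = k%:Z - 1 ->
    (x.1.1 - (count apeak P1)%:Z + (count bpeak P1)%:Z = c %[mod 2])%Z.

Lemma peak_parity_cons (k : nat) (c : int) (w : peak) (P : seq peak) :
  peak_parity k c (w :: P) <->
  (w.1.2 = k%:Z - 1 -> (w.1.1 = c %[mod 2])%Z) /\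
  peak_parity k (c + (apeak w)%:Z - (bpeak w)%:Z) P.
Proof.
split=> [H|[H1 H2] P1 P2 x].
  split=> [|P1 P2 x EP]; first by move/(H [::] P w erefl); rewrite /= subr0 addr0.
  by move=> /(H (w :: P1) P2 x (congr1 (cons w) EP)) /=; lia.
case: P1 => [|w' P1] /= /eqP; rewrite eqseq_cons => /andP[/eqP <- /eqP EP].
  by rewrite subr0 addr0.
by move=> /(H2 _ _ _ EP) H; lia.
Qed.

Lemma goodE (k : nat) (e ne : bool) (y : int) (s : step) (p : seq step) :
  good k e ne y (s :: p) =
  [&& 0 <= y, y < k%:Z,
      legal_step ne y s,
      (y == 0) ==> (peaks false (0, y) (s :: p) != [::]),
      ~~ [&& peak_step ne s, y == k%:Z - 1 & e]
    & good k (e (+) (s == stepE)) (s == stepNE) (y + dy s) p].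
Proof. by []. Qed.

(* Of all steps, only E changes the parity of x - u + v + y. *)
Lemma goodP (k : nat) (c : int) (e ne : bool) (x y : int) (p : seq step) :
  (c = x + y - (k%:Z - 1) + e%:Z %[mod 2])%Z ->
  good k e ne y p <->
  [/\ legal ne (x, y) p, all (fun w : vertex => 0 <= w.2) (vertices (x, y) p),
      all (fun w : vertex => w.2 < k%:Z) (vertices (x, y) p),
      ends_on_axis (x, y) p & peak_parity k c (peaks ne (x, y) p)].
Proof.
elim: p c e ne x y => [|s p IHp] c e ne x y Hc.
  rewrite /= !andbT; split=> [/and3P[-> -> ->]|[_ -> -> ->]] //.
  by split=> // -[].
have par : y = k%:Z - 1 -> (x = c %[mod 2])%Z <-> ~~ e.
  by move=> yk; move: Hc; rewrite yk; clear; case: e => /= Hc; split=> //; lia.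
pose w : peak := ((x, y), s).
pose c' := if peak_step ne s then c + (apeak w)%:Z - (bpeak w)%:Z else c.
have Hpk : peak_parity k c (peaks ne (x, y) (s :: p)) <->
    (peak_step ne s -> y = k%:Z - 1 -> (x = c %[mod 2])%Z) /\
    peak_parity k c' (peaks (s == stepNE) (x + dx s, y + dy s) p).
  rewrite [peaks _ _ _]/= moveE /c' /peak_step; case: ifP => _; last by split=> // -[].
  by rewrite peak_parity_cons; split=> -[H1 H2]; split=> //; apply: H1.
rewrite goodE -(has_peak_translate x).
(* NE, SE and SW change [x + y] by an even number; an S step lowers it by 1, which the change of [c]
   at an a- or b-peak compensates; an E step raises it by 1 and flips the parity [e]. *)
have Hc' : legal_step ne y s ->
    (c' = x + dx s + (y + dy s) - (k%:Z - 1) + (e (+) (s == stepE))%:Z %[mod 2])%Z.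
  rewrite /c' /w /peak_step /apeak /bpeak /dx /dy.
  by case: (s) => //=; rewrite ?andbF ?andbT /= => h; rewrite ?h /=;
     case: (ne); case: (e) Hc => /= Hc; clear -Hc; lia.
split.
  case/and3P=> y0 yk /and4P[st E0 Npk G].
  have /(IHp _ _ _ _ _ (Hc' st))[L W0 Wk E PP] := G.
  split; rewrite ?Hpk /= ?moveE ?y0 ?yk //=.
  - by apply/andP; split=> //; case: (s) (st).
  - by move: E0; rewrite /= !moveE => ->.
  - split=> // ps yk1; move: Npk; rewrite ps yk1 eqxx /=.
    by move/(par yk1).
case=> /= /andP[st L] /andP[y0 W0] /andP[yk Wk] /andP[E0 E].
rewrite Hpk => -[X PP]; rewrite !moveE in L W0 Wk E E0.
have G : good k (e (+) (s == stepE)) (s == stepNE) (y + dy s) p.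
  by apply/(IHp _ _ _ _ _ (Hc' st)); split.
rewrite y0 yk (st : legal_step ne y s) G andbT /= !moveE E0 /=.
by apply/and3P => -[/X ps /eqP yk1 e1]; move: (ps yk1) => /(par yk1); rewrite e1.
Qed.

(** Only SW moves to the left, and it undoes the horizontal effect of the NE step just before it.
    Hence [good] need not mention abscissas. *)
Lemma legal_ge0 (ne : bool) (v : vertex) (p : seq step) :
  legal ne v p -> ne%:Z <= v.1 -> all (fun w : vertex => 0 <= w.1) (vertices v p).
Proof.
elim: p ne v => [|s p IHp] ne v; first by case: ne => /= _; rewrite andbT; lia.
case/andP=> st L v1; apply/andP; split; first by case: (ne) v1; lia.
by apply: IHp L _; case: s st => //= + ; case: (ne) v1; lia.
Qed.

Lemma even_pathE (k i : nat) (p : seq step) :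
  (i <= k)%N -> even_path k i p <-> good k false false (k%:Z - i%:Z) p.
Proof.
move=> ik; rewrite (@goodP k (i%:Z - 1) _ _ 0); last by lia.
split=> [[/and4P[_ L W E] Wk PP]|[L W Wk E PP]]; split=> //.
  by apply: sub_all W => w /andP[].
apply/and4P; split=> //.
have := legal_ge0 L (lexx _) => /(conj W)/andP.
by rewrite -all_predI; apply: sub_all => w /andP[/= -> ->].
Qed.

Lemma good_NE_peak (k : nat) (e : bool) (y : int) (p : seq step) :
  0 < y -> good k e true y p -> peaks true (0, y) p != [::].
Proof.
move=> y0 /(@goodP k (y - (k%:Z - 1) + e%:Z) _ _ 0)[|L _ _ E _]; first by lia.
by apply/eqP => /no_peak_after_NE /(_ y0 L); rewrite E.
Qed.

(** The deleted NE step makes no peak and keeps the parity. If it starts on the x-axis, the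
    condition there holds because a path that has just risen to positive height must still have a
    peak. *)
Lemma gamma_pathE (k i : nat) (p : seq step) :
  (i < k)%N -> even_path k i.+1 (stepNE :: p) <-> good k false true (k%:Z - i%:Z) p.
Proof.
move=> ik; rewrite even_pathE // goodE -size_eq0 size_peaks_cons.
have -> : k%:Z - i.+1%:Z + dy stepNE = k%:Z - i%:Z by rewrite /dy /=; lia.
split=> [/and5P[_ _ _ _ /andP[]]//|G]; apply/and5P; split=> //; try lia.
by rewrite [_ == stepNE]/= size_eq0 (good_NE_peak _ G) ?implybT //; lia.
Qed.

(** Excludes negative major indices. If the path is not entered by NE, all its peaks have abscissa
    at least 1. Otherwise the first peak may lie at 0, and an SW step there lowers the later ones to
    at least 0. *)
Lemma major_peaks_ge (k : nat) (e ne : bool) (y : int) (p : seq step) :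
  good k e ne y p ->
  (if ne then 0 else (size (peaks ne (0, y) p))%:Z) <= major (peaks ne (0, y) p).
Proof.
elim: p e ne y => [|s p IHp] e ne y; first by rewrite /= /major big_nil; case: ne.
rewrite goodE => /and5P[_ _ st _ /andP[_ G]].
have := IHp _ _ _ G; rewrite major_peaks_cons size_peaks_cons.
move: (size (peaks (s == _) _ _)) (major (peaks (s == _) _ _)) => N M.
by case: s st {G} => /= st; case: ne st => //= _; rewrite /peak_step /dx /=; lia.
Qed.

(** Gives finiteness of [paths_from]. The square of the number of peaks pays for an SW step, which
    shifts all remaining peaks to the left; a path without peaks is a descent of length [y]. *)
Lemma size_good (k : nat) (e ne : bool) (y : int) (p : seq step) :
  good k e ne y p -> (size p)%:Z <= major (peaks ne (0, y) p) +
     (size (peaks ne (0, y) p))%:Z * (size (peaks ne (0, y) p))%:Z +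
     (if size (peaks ne (0, y) p) == 0%N then y else k%:Z).
Proof.
elim: p e ne y => [|s p IHp] e ne y.
  by case/and3P=> y0 _ _; rewrite /= /major big_nil; lia.
rewrite goodE -size_eq0 => /and5P[y0 yk st E0 /andP[_ G]].
have := IHp _ _ _ G; rewrite major_peaks_cons size_peaks_cons.
(* An NE step raises the bound only through the abscissas of later peaks, so there must be one. *)
have Npos : (s == stepNE) ==> (size (peaks (s == stepNE) (0, y + dy s) p) != 0%N).
  apply/implyP => /eqP sE; move: G; rewrite sE size_eq0 => /good_NE_peak-> //.
  by rewrite /dy /=; lia.
move: E0 Npos; rewrite size_peaks_cons.
move: (size (peaks (s == _) _ _)) (major (peaks (s == _) _ _)) => N M.
rewrite {IHp G} [size (_ :: _)]/= /peak_step /dx /dy.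
have SN : (1 + N)%N%:Z * (1 + N)%N%:Z = N%:Z * N%:Z + 2 * N%:Z + 1 by rewrite PoszD; ring.
have N0 : N = 0%N -> N%:Z * N%:Z = 0 by move=> ->.
case: s st => /= st; case: ne st => //= st; rewrite ?st ?add0n ?SN.
all: move: N0; set Q := N%:Z * N%:Z; move: Q => Q {SN} N0.
all: case: (altP (N =P 0%N)) => [/[dup]/N0 {}N0 -> | {}N0] //=.
all: lia.
Qed.

(** * First-step recurrences *)

Lemma fsum_cons (R : nmodType) (T : choiceType) (ss : seq T) (S : set (seq T))
    (f : seq T -> R) :
    uniq ss -> finite_set S -> ~ S [::] -> (forall s p, S (s :: p) -> s \in ss) ->
  \sum_(p \in S) f p = \sum_(s <- ss) \sum_(p \in [set p | S (s :: p)]) f (s :: p).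
Proof.
elim: ss S => [|s ss IHss] S Uss Sfin S0 Sss.
  rewrite big_nil; have -> : S = set0 by rewrite -subset0 => -[|s p] // /Sss.
  exact: fsbig_set0.
have {Uss}/andP[sss Uss] : uniq (s :: ss) by [].
rewrite big_cons (fsbigID (range (cons s))) //=; congr (_ + _).
  have -> : S `&` range (cons s) = cons s @` [set p | S (s :: p)].
    apply/seteqP; split=> [p [Sp [p' _ E]]|_ [p Sp <-]]; last by split=> //; exists p.
    by exists p'; rewrite //= E.
  by rewrite fsbig_image // => p p' _ _ [].
rewrite IHss //; last 3 first.
- exact: finite_setIl.
- by case.
- move=> s' p [Sp Np]; have := Sss _ _ Sp; rewrite inE => /predU1P[E|//].
  by case: Np; exists p; rewrite // E.
apply: eq_big_seq => s' s's; apply: eq_fsbigl; apply/seteqP; split=> p /=; first by case.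
by move=> Sp; split=> // -[p' _ [E _]]; move: sss; rewrite E s's.
Qed.

Definition weight (R : comUnitRingType) (a b : R) (P : seq peak) : R :=
  a ^+ count marked_a P * b ^+ count marked_b P.

Definition step_weight (R : comUnitRingType) (a b : R) (s : step) : R :=
  a ^+ (s \in [:: stepSa; stepSW]) * b ^+ (s \in [:: stepSb; stepSW]).

Lemma weight_cons (R : comUnitRingType) (a b : R) (ne : bool) (y : int)
    (s : step) (p : seq step) :
  weight a b (peaks ne (0, y) (s :: p)) =
  (if peak_step ne s then step_weight a b s else 1) *
  weight a b (peaks (s == stepNE) (0, y + dy s) p).
Proof.
rewrite peaks_cons /weight !count_cat !count_map !exprD mulrACA; congr (_ * _).
by case: peak_step; rewrite /= ?mulr1 // !addn0.
Qed.

(** [n] is an integer because the recurrences shift it by the number of peaks in both directions. *)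
Definition paths_from (k : nat) (e ne : bool) (y : int) (N : nat) (n : int) :
    set (seq step) :=
  [set p | [&& good k e ne y p, size (peaks ne (0, y) p) == N
             & major (peaks ne (0, y) p) == n]].

Lemma finite_paths_from (k : nat) (e ne : bool) (y : int) (N : nat) (n : int) :
  finite_set (paths_from k e ne y N n).
Proof.
apply: sub_finite_set (finite_size_le (absz n + N * N + absz y + k)) => p /=.
by case/and3P=> /size_good + /eqP pN /eqP pn; rewrite pN pn; case: ifP; lia.
Qed.

(** By the two implications, a start at height 0 is not entered by NE and [N] is positive, so the
    axis condition of [good] follows from the number of peaks. *)
Lemma paths_from_cons (k : nat) (e ne : bool) (y : int) (N : nat) (n : int) (s : step) :
    0 <= y < k%:Z -> (ne -> y != 0) -> (N = 0%N -> y != 0) ->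
  [set p | paths_from k e ne y N n (s :: p)] =
  if [&& legal_step ne y s, ~~ [&& peak_step ne s, y == k%:Z - 1 & e]
       & peak_step ne s ==> (0 < N)%N]
  then paths_from k (e (+) (s == stepE)) (s == stepNE) (y + dy s)
         (N - peak_step ne s) (n - dx s * (N - peak_step ne s)%N%:Z)
  else set0.
Proof.
move=> /andP[y0 yk] neP NP.
have key p : [&& good k e ne y (s :: p), size (peaks ne (0, y) (s :: p)) == N
             & major (peaks ne (0, y) (s :: p)) == n] =
  [&& legal_step ne y s, ~~ [&& peak_step ne s, y == k%:Z - 1 & e],
       peak_step ne s ==> (0 < N)%N &
      [&& good k (e (+) (s == stepE)) (s == stepNE) (y + dy s) p,
          size (peaks (s == stepNE) (0, y + dy s) p) == (N - peak_step ne s)%N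
        & major (peaks (s == stepNE) (0, y + dy s) p) ==
          n - dx s * (N - peak_step ne s)%N%:Z]].
  apply/idP/idP.
    case/and3P; rewrite goodE => /and5P[_ _ st _ /andP[Npk G]].
    rewrite size_peaks_cons major_peaks_cons => /eqP <- /eqP <-.
    by rewrite addKn addrK !eqxx G Npk (st : legal_step ne y s); case: peak_step.
  case/and4P=> st Npk NN /and3P[G /eqP sz /eqP mj].
  have szN : size (peaks ne (0, y) (s :: p)) = N.
    by rewrite size_peaks_cons sz subnKC //; move: NN; case: peak_step.
  rewrite szN major_peaks_cons mj sz subrK !eqxx !andbT goodE.
  apply/and5P; split=> //; last by rewrite Npk.
  apply/implyP => y00; case: (ne) neP szN => [/(_ isT)/negP[]//|_ szN].
  by rewrite -size_eq0 szN; apply/eqP => /NP; rewrite y00.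
apply/seteqP; case: ifP => [/and3P[c1 c2 c3]|c]; split=> p /=;
  rewrite /paths_from /= key ?c1 ?c2 ?c3 //.
by case/and4P=> c1 c2 c3; rewrite c1 c2 c3 in c.
Qed.

Definition path_sum (R : comUnitRingType) (a b : R) (k : nat) (e ne : bool)
    (y : int) (N : nat) (n : int) : R :=
  \sum_(p \in paths_from k e ne y N n) weight a b (peaks ne (0, y) p).

Lemma path_sum_out (R : comUnitRingType) (a b : R) (k : nat) (e ne : bool)
    (y : int) (N : nat) (n : int) :
  ~~ (0 <= y < k%:Z) || (n < 0) -> path_sum a b k e ne y N n = 0.
Proof.
move=> H; rewrite /path_sum (_ : paths_from _ _ _ _ _ _ = set0) ?fsbig_set0 //.
rewrite -subset0 => p /= /and3P[G _ /eqP pn]; have := major_peaks_ge G.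
have yk : 0 <= y < k%:Z by case: p G {pn} => [|s p] /and3P[-> ->].
by move: H; rewrite yk pn /=; case: ne {G pn}; lia.
Qed.

Lemma path_sum_step (R : comUnitRingType) (a b : R) (k : nat) (e ne : bool)
    (y : int) (N : nat) (n : int) :
    0 <= y < k%:Z -> (ne -> y != 0) -> (N = 0%N -> y != 0) ->
  path_sum a b k e ne y N n =
  \sum_(s <- [:: stepNE; stepSE; stepSa; stepSb; stepSW; stepE] |
      [&& legal_step ne y s, ~~ [&& peak_step ne s, y == k%:Z - 1 & e]
       & peak_step ne s ==> (0 < N)%N])
    (if peak_step ne s then step_weight a b s else 1) *
    path_sum a b k (e (+) (s == stepE)) (s == stepNE) (y + dy s)
         (N - peak_step ne s) (n - dx s * (N - peak_step ne s)%N%:Z).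
Proof.
move=> yk neP NP.
rewrite /path_sum (@fsum_cons _ _ [:: stepNE; stepSE; stepSa; stepSb; stepSW; stepE]) //.
- rewrite [RHS]big_mkcond; apply: eq_bigr => s _; rewrite paths_from_cons //.
  case: ifP => _; last by rewrite fsbig_set0.
  rewrite fsbig_distrr; last exact: finite_paths_from.
  by apply: eq_fsbigr => p _; rewrite weight_cons.
- exact: finite_paths_from.
- case/and3P=> /and3P[_ _ /eqP yE] /eqP NE _.
  by move: (NP (esym NE)); rewrite yE.
- by case.
Qed.

Lemma path_sum0_NE (R : comUnitRingType) (a b : R) (k : nat) (e : bool)
    (y n : int) : 0 < y -> path_sum a b k e true y 0 n = 0.
Proof.
move=> y0; rewrite /path_sum (_ : paths_from _ _ _ _ _ _ = set0) ?fsbig_set0 //.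
by rewrite -subset0 => p /and3P[/(good_NE_peak y0) + /eqP/size0nil E _]; rewrite E.
Qed.

Lemma path_sum_false (R : comUnitRingType) (a b : R) (k : nat) (e : bool)
    (y : int) (N : nat) (n : int) :
    0 <= y < k%:Z -> (N = 0%N -> y != 0) ->
  path_sum a b k e false y N n =
  path_sum a b k e true (y + 1) N (n - N%:Z) +
  (path_sum a b k e false (y - 1) N (n - N%:Z) +
   (if y == 0 then path_sum a b k (~~ e) false 0 N (n - N%:Z) else 0)).
Proof.
move=> yk NP; rewrite path_sum_step // !big_cons big_nil /= /peak_step /dx /dy /=.
rewrite !subn0 !mul1r !add0r !addbF ?addbT ?addr0.
by rewrite andbT; case: (y =P 0) => [->|].
Qed.

Lemma path_sum_true (R : comUnitRingType) (a b : R) (k : nat) (e : bool)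
    (y : int) (N : nat) (n : int) :
    0 < y < k%:Z ->
  path_sum a b k e true y N.+1 n =
  path_sum a b k e true (y + 1) N.+1 (n - N.+1%:Z) +
  (if (y == k%:Z - 1) && e then 0 else
   path_sum a b k e false (y - 1) N (n - N%:Z) +
   ((a + b) * path_sum a b k e false (y - 1) N n +
    a * b * path_sum a b k e false (y - 1) N (n + N%:Z))).
Proof.
move=> /andP[y0 yk]; rewrite path_sum_step //; try lia.
rewrite !big_cons big_nil /= /peak_step /dx /dy /= /step_weight /=.
rewrite (gt_eqF y0).
rewrite ?(subn0, subn1, mul0r, sub0r, mul1r, add0r, addbF, expr0, expr1, mulr1, subr0).
case: (_ && e); rewrite /= ?addr0 //.
by rewrite mulN1r opprK; ring.
Qed.

(** Without peaks only the SE descent remains: NE forces a later peak, and so does any step made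
    from the x-axis. *)
Lemma path_sum0 (R : comUnitRingType) (a b : R) (k : nat) (e : bool) (y n : int) :
  0 <= y < k%:Z -> path_sum a b k e false y 0 n = (n == 0)%:R.
Proof.
case: y => // y; elim: y => [|y IHy] yk.
  have k0 : 0 < k%:Z by lia.
  have PE : paths_from k e false 0 0 n = if n == 0 then [set [::]] else set0.
    apply/seteqP; split=> [[|s p]|[|s p]] /=; last by case: eqP.
    - by rewrite /paths_from /= k0 /major big_nil eq_sym => /andP[_ ->].
    - case/and3P; rewrite goodE -size_eq0 => /and5P[_ _ _ E0 _] sz _.
      by move: E0; rewrite sz.
    - by case: eqP => // -> _; rewrite /paths_from /= k0 /major big_nil eqxx.
  rewrite /path_sum PE; case: eqP => _; last exact: fsbig_set0.
  by rewrite fsbig_set1 /weight /= mulr1.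
rewrite path_sum_false // path_sum0_NE // add0r subr0 addr0.
have -> : y.+1%:Z - 1 = y%:Z by lia.
by rewrite IHy //; lia.
Qed.

(* Lowering by 1 the part of an even path before its first visit to the x-axis
   replaces the SE step that ends it by an E step; this is the bijection behind
   the identity, which the first-step recurrences give directly. *)
Lemma path_sum_odd (R : comUnitRingType) (a b : R) (k N : nat) (n : int) :
  (forall y : int, 0 <= y < k%:Z - 1 ->
     path_sum a b k true false y N n = path_sum a b k false false (y + 1) N n) /\
  (forall y : int, 0 < y < k%:Z ->
     path_sum a b k true true y N n = path_sum a b k false true (y + 1) N n).
Proof.
elim: N n => [|N IHN] n.
  by split=> y yk; [rewrite !path_sum0 //; lia|rewrite !path_sum0_NE //; lia].
(* Inner induction on a bound for [n]: steps that keep the number of peaks shift [n] down by it, and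
   the sums vanish for negative [n]. *)
have [m] : exists m : nat, n < m%:Z by exists (absz n).+1; lia.
elim: m n => [|m IHm] n nm; first by split=> y yk; rewrite !path_sum_out ?nm ?orbT.
have [IHf IHt] := IHm (n - N.+1%:Z) ltac:(lia).
split=> y yk.
  rewrite [LHS]path_sum_false //; last by lia.
  rewrite [RHS]path_sum_false //; last by lia.
  rewrite IHt; last by lia.
  have -> : (y + 1 == 0) = false by lia.
  (* At [y = 0] the E step on the left restores even parity at height 0, matching the SE step from
     height 1 on the right. *)
  rewrite addr0 addrK; case: eqP => [->|/eqP y0].
    by rewrite [in LHS](@path_sum_out _ _ _ _ true false (0 - 1)) ?add0r //; lia.
  by rewrite addr0 IHf ?subrK //; lia.
(* At the top both sides vanish: odd parity forbids a peak and NE leaves the strip, while the right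
   side starts outside it. *)
have [y1|y1] := eqVneq y (k%:Z - 1).
  rewrite path_sum_true // y1 eqxx /= addr0 subrK !path_sum_out //; first by lia.
  by lia.
rewrite [LHS]path_sum_true // [RHS]path_sum_true; last by lia.
rewrite (negbTE y1) ?andbF /= ?addrK.
rewrite IHt; last by lia.
have yE : y = y - 1 + 1 by rewrite subrK.
have y1k : 0 <= y - 1 < k%:Z - 1 by lia.
by rewrite ![path_sum _ _ _ true false _ _ _](proj1 (IHN _) _ y1k) -yE.
Qed.

(** * The sums of the formulas *)

Lemma fps_coefCM (R : comNzRingType) (c : R) (f : fps R) (n : nat) :
  fps_coef (fpsC c * f) n = c * fps_coef f n.
Proof.
rewrite /= big_ord_recl /= subn0 big1 ?addr0 // => j _.
by rewrite mul0r.
Qed.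

Lemma fps_coefXnM (R : comNzRingType) (m : nat) (f : fps R) (n : nat) :
  fps_coef (fpsX ^+ m * f) n = if (n < m)%N then 0 else fps_coef f (n - m).
Proof.
have XM (g : fps R) l : fps_coef (fpsX * g) l = if l is l'.+1 then fps_coef g l' else 0.
  case: l => [|l] /=; first by rewrite big_ord_recl big_ord0 mul0r addr0.
  rewrite !big_ord_recl /= mul0r add0r mul1r big1 ?addr0 ?subn1 // => j _.
  by rewrite mul0r.
elim: m n => [|m IHm] n; first by rewrite expr0 mul1r subn0.
by rewrite exprS -mulrA XM; case: n => // n; rewrite IHm ltnS.
Qed.

Lemma fps_XnI (R : comNzRingType) (m : nat) (f g : fps R) :
  fpsX ^+ m * f = fpsX ^+ m * g -> f = g.
Proof.
move=> E; apply: fpsP => n; have := congr1 (fun h => fps_coef h (n + m)) E.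
by rewrite !fps_coefXnM ltnNge leq_addl /= addnK.
Qed.

Lemma fps_unitE (R : comUnitRingType) (f : fps R) :
  (f \is a GRing.unit) = (fps_coef f 0 \is a GRing.unit).
Proof. by []. Qed.

Lemma fps_unit_1subXn (R : comUnitRingType) (m : nat) :
  (0 < m)%N -> 1 - fpsX ^+ m \is a @GRing.unit (fps R).
Proof.
move=> m0; have X0 : fps_coef (fpsX ^+ m) 0 = 0 :> R.
  by rewrite -[fpsX ^+ m]mulr1 fps_coefXnM m0.
by rewrite fps_unitE /= X0 subr0 unitr1.
Qed.

Definition qfact_inv (R : comUnitRingType) (n : nat) : fps R := (qpoch fpsX fpsX n)^-1.

Lemma unit_qpoch (R : comUnitRingType) (n : nat) :
  qpoch fpsX fpsX n \is a @GRing.unit (fps R).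
Proof.
rewrite /qpoch; elim/big_ind: _ => [|f g Uf Ug|j _]; rewrite ?unitr1 ?unitrM ?Uf //.
by rewrite -exprS fps_unit_1subXn.
Qed.

Lemma qfact_invS (R : comUnitRingType) (n : nat) :
  (1 - fpsX ^+ n.+1) * qfact_inv R n.+1 = qfact_inv R n.
Proof.
rewrite /qfact_inv; have -> : qpoch fpsX fpsX n.+1 =
  qpoch fpsX fpsX n * (1 - fpsX ^+ n.+1) :> fps R by rewrite /qpoch big_ord_recr exprS.
by rewrite invrM ?unit_qpoch ?fps_unit_1subXn // mulVKr ?fps_unit_1subXn.
Qed.

(** The exponent of the formulas after cancelling [2 * binz2 n = n * (n - 1)], with [y = k - i] for
    E and [y = k - i - 1] for Gamma. *)
Definition quad (k : nat) (y n : int) : int := (k%:Z - 1) * (n * n) + y * n.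

(* [fpsX] is not invertible, so [fpsX ^ m] is a junk value for negative m. *)
Lemma quad_ge0 (k : nat) (y n : int) :
  (0 < k)%N -> `|y| <= k%:Z - 1 -> 0 <= quad k y n.
Proof.
move=> k0; rewrite ler_norml => /andP[yl yu]; have K0 : 0 <= k%:Z - 1 by lia.
have [n0|n0] := leP 0 n.
  have -> : quad k y n = (k%:Z - 1) * (n * (n - 1)) + (y + (k%:Z - 1)) * n.
    by rewrite /quad; ring.
  have n1 : 0 <= n * (n - 1) by nia.
  by rewrite addr_ge0 // mulr_ge0 //; lia.
have -> : quad k y n = (k%:Z - 1) * (n * (n + 1)) + (k%:Z - 1 - y) * (- n).
  by rewrite /quad; ring.
have n1 : 0 <= n * (n + 1) by nia.
by rewrite addr_ge0 // mulr_ge0 //; lia.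
Qed.

(** The index is [j = n + N], and [j + N] has the parity of [n]. *)
Definition Esum (R : comUnitRingType) (k : nat) (y : int) (N : nat) : fps R :=
  \sum_(j < (N + N).+1) (-1) ^+ (j + N) *
    (fpsX ^+ absz (quad k y (j%:Z - N%:Z)) * (qfact_inv R (N + N - j) * qfact_inv R j)).

Definition Gsum (R : comUnitRingType) (k : nat) (y : int) (N : nat) : fps R :=
  \sum_(j < N + N) (-1) ^+ (j + N) *
    (fpsX ^+ absz (quad k y (j%:Z - N%:Z)) *
      (qfact_inv R (N + N - j).-1 * qfact_inv R j)).

(** Since [quad k (y - 1) n = quad k y n - n], the terms at [n] differ by a factor [1 - q^(N - n)],
    which cancels against [(q)_(N - n)] and kills the term [n = N]. *)
Lemma Esum_rec (R : comUnitRingType) (k : nat) (y : int) (N : nat) :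
    (0 < k)%N -> `|y| <= k%:Z - 1 -> `|y - 1| <= k%:Z - 1 ->
  Esum R k y N = Gsum R k y N + fpsX ^+ N * Esum R k (y - 1) N.
Proof.
move=> k0 y0 y1.
have Xw (j : 'I_(N + N).+1) :
    fpsX ^+ N * fpsX ^+ absz (quad k (y - 1) (j%:Z - N%:Z)) =
    fpsX ^+ absz (quad k y (j%:Z - N%:Z)) * fpsX ^+ (N + N - j) :> fps R.
  rewrite -!exprD; congr (_ ^+ _).
  have := quad_ge0 (j%:Z - N%:Z) k0 y0; have := quad_ge0 (j%:Z - N%:Z) k0 y1.
  have -> : quad k (y - 1) (j%:Z - N%:Z) = quad k y (j%:Z - N%:Z) - (j%:Z - N%:Z).
    by rewrite /quad; ring.
  by have := ltn_ord j; lia.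
apply/eqP; rewrite -subr_eq; apply/eqP.
rewrite mulr_sumr -sumrB big_ord_recr /= addrC -[RHS]add0r; congr (_ + _).
  set f := fpsX ^+ N * _; have -> : f = (-1) ^+ (N + N + N) *
      (fpsX ^+ absz (quad k y ((N + N)%N%:Z - N%:Z)) *
        (qfact_inv R (N + N - (N + N)) * qfact_inv R (N + N))).
    have := Xw ord_max; rewrite /= subnn expr0 mulr1 /f subnn => <-; ring.
  by rewrite subrr.
apply: eq_bigr => j _; have := Xw (widen_ord (leqnSn _) j) => /= XwE.
have [m mE] : exists m, (N + N - j)%N = m.+1.
  by exists (N + N - j).-1; have := ltn_ord j; lia.
rewrite mE /= in XwE *.
rewrite -(qfact_invS R m) (mulrCA (fpsX ^+ N)) (mulrA (fpsX ^+ N)) XwE.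
by move: (fpsX ^+ m.+1) => X; ring.
Qed.

(** Here the factor is [1 - q^(N + 1 + n)]: it kills the lowest term, [n = - N - 1], and the others
    form the sum for [N]. *)
Lemma Gsum_rec (R : comUnitRingType) (k : nat) (y : int) (N : nat) :
    (0 < k)%N -> `|y| <= k%:Z - 1 -> `|y - 1| <= k%:Z - 1 ->
  Gsum R k (y - 1) N.+1 = fpsX ^+ N.+1 * Gsum R k y N.+1 + Esum R k (y - 1) N.
Proof.
move=> k0 y0 y1.
have Xw (j : nat) :
    fpsX ^+ N.+1 * fpsX ^+ absz (quad k y (j%:Z - N.+1%:Z)) =
    fpsX ^+ absz (quad k (y - 1) (j%:Z - N.+1%:Z)) * fpsX ^+ j :> fps R.
  rewrite -!exprD; congr (_ ^+ _).
  have := quad_ge0 (j%:Z - N.+1%:Z) k0 y0; have := quad_ge0 (j%:Z - N.+1%:Z) k0 y1.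
  have -> : quad k (y - 1) (j%:Z - N.+1%:Z) = quad k y (j%:Z - N.+1%:Z) - (j%:Z - N.+1%:Z).
    by rewrite /quad; ring.
  lia.
apply/eqP; rewrite [X in _ == X]addrC -subr_eq; apply/eqP.
rewrite /Gsum mulr_sumr -sumrB addSn addnS big_ord_recl -[RHS]add0r; congr (_ + _).
  by have := Xw 0%N; rewrite expr0 mulr1 => <- /=;
     rewrite (mulrCA (fpsX ^+ N.+1)) (mulrA (fpsX ^+ N.+1)) subrr.
apply: eq_bigr => j _; rewrite lift0.
have := Xw j.+1; have -> : j.+1%:Z - N.+1%:Z = j%:Z - N%:Z by lia.
have -> : ((N + N).+2 - j.+1).-1 = (N + N - j)%N by lia.
rewrite (mulrCA (fpsX ^+ N.+1)) (mulrA (fpsX ^+ N.+1)) => ->.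
by rewrite -(qfact_invS R j) addSn addnS !exprS; move: (fpsX * fpsX ^+ j) => X; ring.
Qed.

Lemma Esum_sym (R : comUnitRingType) (k : nat) (y : int) (N : nat) :
  Esum R k (- y) N = Esum R k y N.
Proof.
rewrite /Esum (reindex_inj rev_ord_inj); apply: eq_bigr => j _ /=.
have jN := ltn_ord j; rewrite subSS.
have -> : (-1) ^+ (N + N - j + N) = (-1) ^+ (j + N) :> fps R.
  by rewrite -signr_odd -[RHS]signr_odd; congr (_ ^+ _); lia.
have -> : (N + N - (N + N - j))%N = j by lia.
have -> : quad k (- y) ((N + N - j)%N%:Z - N%:Z) = quad k y (j%:Z - N%:Z).
  have -> : (N + N - j)%N%:Z - N%:Z = - (j%:Z - N%:Z) by lia.
  by rewrite /quad; ring.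
ring.
Qed.

(** The exponent [(k - 1) * n * (n + 1)] is invariant under [n -> -1 - n], which swaps the two
    denominators and changes the sign. This matches the absence of paths from height [k]. *)
Lemma Gsum_top (R : comUnitRingType) (k N : nat) : Gsum R k (k%:Z - 1) N = 0.
Proof.
rewrite /Gsum big_split_ord /= (reindex_inj rev_ord_inj) /= -big_split big1 // => j _ /=.
have jN := ltn_ord j.
set A := fpsX ^+ _; set B := fpsX ^+ _.
have -> : A = B.
  congr (_ ^+ absz _).
  have -> : (N - j.+1)%N%:Z - N%:Z = - 1 - ((N + j)%N%:Z - N%:Z) by lia.
  by rewrite /quad; ring.
have -> : (N + N - (N - j.+1)).-1 = (N + j)%N by lia.
have -> : (N + N - (N + j)).-1 = (N - j.+1)%N by lia.
have -> : (-1) ^+ (N + j + N) = - (-1) ^+ (N - j.+1 + N) :> fps R.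
  rewrite -[RHS]mulN1r -exprS -signr_odd -[RHS]signr_odd; congr (_ ^+ _); lia.
ring.
Qed.

(** * The recurrences for generating functions *)

Definition path_gf (R : comUnitRingType) (a b : R) (k : nat) (ne : bool)
    (y : int) (N : nat) : fps R :=
  Fps (fun n => path_sum a b k false ne y N n%:Z).

Lemma E_gfE (R : comUnitRingType) (a b : R) (k i N : nat) :
  (i <= k)%N -> E_gf a b k i N = path_gf a b k false (k%:Z - i%:Z) N.
Proof.
move=> ik; apply: fpsP => n; apply: eq_fsbigl; apply/seteqP; split=> p /=.
  by case=> /(even_pathE _ ik) G /eqP pN /eqP pn; apply/and3P.
by case/and3P=> /(even_pathE _ ik) G /eqP pN /eqP pn.
Qed.

Lemma Gamma_gfE (R : comUnitRingType) (a b : R) (k i N : nat) :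
  (i < k)%N -> Gamma_gf a b k i N = path_gf a b k true (k%:Z - i%:Z) N.
Proof.
move=> ik; apply: fpsP => n; apply: eq_fsbigl; apply/seteqP; split=> p /=.
  by case=> /(gamma_pathE _ ik) G /eqP pN /eqP pn; apply/and3P.
by case/and3P=> /(gamma_pathE _ ik) G /eqP pN /eqP pn.
Qed.

Lemma path_gf_shift (R : comUnitRingType) (a b : R) (k : nat) (ne : bool)
    (y : int) (N m n : nat) :
  fps_coef (fpsX ^+ m * path_gf a b k ne y N) n =
  path_sum a b k false ne y N (n%:Z - m%:Z).
Proof.
rewrite fps_coefXnM; case: ltnP => mn; last by rewrite /= subzn.
by rewrite path_sum_out //; apply/orP; right; lia.
Qed.

Lemma fps_coefD (R : comNzRingType) (f g : fps R) (n : nat) :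
  fps_coef (f + g) n = fps_coef f n + fps_coef g n.
Proof. by []. Qed.

Lemma path_gf_out (R : comUnitRingType) (a b : R) (k : nat) (ne : bool)
    (y : int) (N : nat) :
  ~~ (0 <= y < k%:Z) -> path_gf a b k ne y N = 0.
Proof. by move=> yk; apply: fpsP => n; rewrite /= path_sum_out // yk. Qed.

Lemma path_gf_false (R : comUnitRingType) (a b : R) (k : nat) (y : int) (N : nat) :
    0 < y < k%:Z ->
  path_gf a b k false y N =
  fpsX ^+ N * (path_gf a b k true (y + 1) N + path_gf a b k false (y - 1) N).
Proof.
case/andP=> y0 yk; apply: fpsP => n; rewrite mulrDr fps_coefD !path_gf_shift /=.
by rewrite path_sum_false ?(gt_eqF y0) ?addr0 // ltW.
Qed.

(** [path_sum_odd] turns the odd sum left by the E step into an even one at height 1, so the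
    recurrences close up on even parity. *)
Lemma path_gf_false0 (R : comUnitRingType) (a b : R) (k : nat) (N : nat) :
    (1 < k)%N ->
  path_gf a b k false 0 N.+1 =
  fpsX ^+ N.+1 * (path_gf a b k true 1 N.+1 + path_gf a b k false 1 N.+1).
Proof.
move=> k1; apply: fpsP => n; rewrite mulrDr fps_coefD !path_gf_shift /=.
rewrite path_sum_false //; last by lia.
rewrite eqxx /= (proj1 (path_sum_odd _ _ _ _ _)) ?add0r; last by lia.
by rewrite (@path_sum_out _ _ _ _ _ _ (- 1)) ?add0r //; lia.
Qed.

(** Multiplying by [fpsX ^+ N] clears the left shift at an ab-peak; 1-, a-, b- and ab-peaks then
    contribute [q^(2N)], [a q^N], [b q^N] and [a b], whence the product. *)
Lemma path_gf_true (R : comUnitRingType) (a b : R) (k : nat) (y : int) (N : nat) :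
    0 < y < k%:Z ->
  fpsX ^+ N * path_gf a b k true y N.+1 =
  fpsX ^+ N * (fpsX ^+ N.+1 * path_gf a b k true (y + 1) N.+1) +
  (fpsC a + fpsX ^+ N) * (fpsC b + fpsX ^+ N) * path_gf a b k false (y - 1) N.
Proof.
move=> yk; set f := path_gf _ _ _ false _ _.
have -> : (fpsC a + fpsX ^+ N) * (fpsC b + fpsX ^+ N) * f =
  fpsC a * (fpsC b * f) + (fpsC a * (fpsX ^+ N * f) +
  (fpsC b * (fpsX ^+ N * f) + fpsX ^+ (N + N) * f)) by rewrite exprD; ring.
apply: fpsP => n; rewrite mulrA -exprD !fps_coefD !fps_coefCM !path_gf_shift.
rewrite path_sum_true // andbF subrK !PoszD !opprD !addrA /=; ring.
Qed.

Definition peak_factor (R : comUnitRingType) (a b : R) (N : nat) : fps R :=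
  \prod_(j < N) ((fpsC a + fpsX ^+ j) * (fpsC b + fpsX ^+ j)).

Lemma path_gf_formula (R : comUnitRingType) (a b : R) (k N : nat) :
    (1 < k)%N ->
  (forall y : int, 0 <= y < k%:Z ->
     path_gf a b k false y N = peak_factor a b N * (fpsX ^+ N * Esum R k y N)) /\
  (forall y : int, 0 < y <= k%:Z ->
     path_gf a b k true y N = peak_factor a b N * Gsum R k (y - 1) N).
Proof.
move=> k1; elim: N => [|N [IHE _]].
  split=> y yk.
    rewrite /peak_factor big_ord0 !mul1r /Esum big_ord1 /= /quad.
    rewrite !mulr0 addr0 !expr0 !mul1r.
    rewrite /qfact_inv /qpoch big_ord0 invr1 mulr1.
    by apply: fpsP => n; rewrite /= path_sum0 //; case: n.
  rewrite /Gsum big_ord0 mulr0; apply: fpsP => n.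
  by rewrite /= path_sum0_NE //; case/andP: yk.
(* Downward induction on the height, from [y = k] where both sides vanish; the sums with one peak
   fewer come from [IHE]. *)
have G y : 0 < y <= k%:Z ->
    path_gf a b k true y N.+1 = peak_factor a b N.+1 * Gsum R k (y - 1) N.+1.
  have [d] : exists d : nat, k%:Z - y = d%:Z \/ k%:Z < y by exists (absz (k%:Z - y)); lia.
  elim: d y => [|d IHd] y [yd|ky] yk; try lia.
    have -> : y = k by lia.
    by rewrite Gsum_top mulr0 path_gf_out //; lia.
  apply: (@fps_XnI _ N); rewrite path_gf_true; last by lia.
  rewrite IHd; [|by lia|by lia]; rewrite IHE; last by lia.
  rewrite addrK Gsum_rec; [|by lia|by lia|by lia].
  rewrite /peak_factor big_ord_recr /=; ring.
split=> //.
(* The discrepancy [D] satisfies the homogeneous recurrences, so [D 0 = q^(2N+2) * D 0]; this forces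
   [D 0 = 0], which propagates upwards. *)
pose D y := path_gf a b k false y N.+1 -
  peak_factor a b N.+1 * (fpsX ^+ N.+1 * Esum R k y N.+1).
have DS y : 0 < y < k%:Z -> D y = fpsX ^+ N.+1 * D (y - 1).
  move=> yk; rewrite /D path_gf_false // G; last by lia.
  rewrite addrK Esum_rec; [|by lia|by lia|by lia].
  by move: (fpsX ^+ N.+1) => X; ring.
have D0 : D 0 = fpsX ^+ N.+1 * D 1.
  rewrite /D path_gf_false0 // G; last by lia.
  rewrite subrr Esum_rec; [|by lia|by lia|by lia].
  (* The symmetry [n -> -n] replaces height -1 by height 1, as the E step does for paths. *)
  rewrite sub0r Esum_sym; move: (fpsX ^+ N.+1) => X; ring.
have D00 : D 0 = 0.
  have U : 1 - fpsX ^+ (N.+1 + N.+1) \is a @GRing.unit (fps R).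
    exact: fps_unit_1subXn.
  apply: (mulrI U); rewrite mulr0 mulrBl mul1r exprD -mulrA.
  by rewrite {1}D0 DS ?subrr //; lia.
suff Dy y : 0 <= y < k%:Z -> D y = 0 by move=> y /Dy /eqP; rewrite subr_eq0 => /eqP.
case: y => // y; elim: y => [|y IHy] yk; first exact: D00.
rewrite DS; last by lia.
have -> : y.+1%:Z - 1 = y%:Z by lia.
by rewrite IHy ?mulr0 //; lia.
Qed.

(** * Translation to the stated formulas *)

Lemma fpsC_unit (R : comUnitRingType) (c : R) :
  c \is a GRing.unit -> fpsC c \is a @GRing.unit (fps R).
Proof. by []. Qed.

Lemma peak_factorE (R : comUnitRingType) (a b : R) (N : nat) :
    a \is a GRing.unit -> b \is a GRing.unit ->
  (fpsC a * fpsC b) ^+ N *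
    (qpoch (- 1 / fpsC a) fpsX N * qpoch (- 1 / fpsC b) fpsX N) =
  peak_factor a b N.
Proof.
move=> Ua Ub.
have E (c : R) j : c \is a GRing.unit ->
    fpsC c * (1 - (- 1 / fpsC c) * fpsX ^+ j) = fpsC c + fpsX ^+ j.
  move=> /fpsC_unit Uc; rewrite mulrBr mulr1 mulNr mul1r mulNr mulrN opprK.
  by rewrite mulVKr.
rewrite /qpoch /peak_factor -big_split /= -[X in _ ^+ X](card_ord N) -prodr_const.
rewrite -big_split; apply: eq_bigr => j _ /=.
by rewrite mulrACA !E.
Qed.

Lemma big_zrange (R : nmodType) (m M : int) (F : int -> R) :
  m <= M -> \sum_(n <- zrange m M) F n = \sum_(j < (absz (M - m)).+1) F (m + j%:Z).
Proof.
move=> mM; rewrite /zrange mM big_map.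
by rewrite -[X in iota _ X]subn0 -/(index_iota _ _) big_mkord.
Qed.

Lemma double_binz2 (n : int) : 2 * binz2 n = n * (n - 1).
Proof.
rewrite /binz2 mulrC divzK //.
have [m [->|->]] : exists m : int, n = m * 2 \/ n = m * 2 + 1.
  by exists (n %/ 2)%Z; lia.
  by rewrite -mulrA mulrCA dvdz_mulr.
by rewrite addrK mulrA dvdz_mull.
Qed.

Lemma signz_shift (A : unitRingType) (j N : nat) :
  (- 1 : A) ^ (- N%:Z + j%:Z) = (- 1) ^+ (j + N).
Proof.
by rewrite exprzDr ?unitrN1 // -exprnN -exprVn invrN1 -exprnP -exprD addnC.
Qed.

Lemma exprz_quad (R : comUnitRingType) (k : nat) (y n e : int) :
    (0 < k)%N -> `|y| <= k%:Z - 1 -> e = quad k y n ->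
  (fpsX : fps R) ^ e = fpsX ^+ absz (quad k y n).
Proof.
move=> k0 yk ->; have := quad_ge0 n k0 yk.
by case: (quad k y n).
Qed.

Theorem theorem6 (R : comUnitRingType) (a b : R)
    (ha : a \is a GRing.unit) (hb : b \is a GRing.unit)
    (k : nat) (hk : (2 <= k)%N) :
  let A : fps R := fpsC a in
  let B : fps R := fpsC b in
  let q : fps R := fpsX in
  (forall i N : nat, (0 < i <= k)%N ->
     E_gf a b k i N =
       (A * B) ^+ N * (qpoch (- 1 / A) q N * qpoch (- 1 / B) q N) * q ^+ N *
       \sum_(n <- zrange (- N%:Z) N%:Z)
         (- 1) ^ n *
         (q ^ (k%:Z * n ^+ 2 + (k%:Z - i%:Z - 1) * n - 2 * binz2 n) /
          (qpoch q q (absz (N%:Z - n)%R) * qpoch q q (absz (N%:Z + n)%R))))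
  /\
  (forall i N : nat, (i < k)%N ->
     Gamma_gf a b k i N =
       (A * B) ^+ N * (qpoch (- 1 / A) q N * qpoch (- 1 / B) q N) *
       \sum_(n <- zrange (- N%:Z) (N%:Z - 1))
         (- 1) ^ n *
         (q ^ (k%:Z * n ^+ 2 + (k%:Z - i%:Z - 2) * n - 2 * binz2 n) /
          (qpoch q q (absz (N%:Z - n - 1)%R) * qpoch q q (absz (N%:Z + n)%R)))).
Proof.
move=> A B q; split=> i N ik.
  have /andP[i0 ik'] := ik.
  rewrite E_gfE // (proj1 (path_gf_formula _ _ _ hk)); last by lia.
  rewrite peak_factorE // -mulrA; congr (_ * (_ * _)).
  rewrite big_zrange; last by lia.
  have -> : absz (N%:Z - - N%:Z) = (N + N)%N by lia.
  apply: eq_bigr => j _; have jN := ltn_ord j.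
  rewrite signz_shift [- _ + _]addrC; congr (_ * _).
  rewrite (@exprz_quad _ k (k%:Z - i%:Z) (j%:Z - N%:Z)); [|by lia|by lia|]; last first.
    by rewrite double_binz2 /quad expr2; ring.
  have -> : absz (N%:Z - (j%:Z - N%:Z))%R = (N + N - j)%N by lia.
  have -> : absz (N%:Z + (j%:Z - N%:Z))%R = j by lia.
  by rewrite invrM ?unit_qpoch // [X in _ = _ * X]mulrC.
rewrite Gamma_gfE // (proj2 (path_gf_formula _ _ _ hk)); last by lia.
rewrite peak_factorE //; congr (_ * _).
(* For [N = 0] the range from 0 to -1 is empty, outside the scope of [big_zrange]. *)
case: N => [|N]; first by rewrite /Gsum big_ord0 /zrange big_nil.
rewrite big_zrange; last by lia.
have -> : (absz (N.+1%:Z - 1 - - N.+1%:Z)%R).+1 = (N.+1 + N.+1)%N by lia.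
apply: eq_bigr => j _; have jN := ltn_ord j.
rewrite signz_shift [- _ + _]addrC; congr (_ * _).
rewrite (@exprz_quad _ k (k%:Z - i%:Z - 1) (j%:Z - N.+1%:Z)); [|by lia|by lia|]; last first.
  by rewrite double_binz2 /quad expr2; ring.
have -> : absz (N.+1%:Z - (j%:Z - N.+1%:Z) - 1)%R = (N.+1 + N.+1 - j).-1 by lia.
have -> : absz (N.+1%:Z + (j%:Z - N.+1%:Z))%R = j by lia.
by rewrite invrM ?unit_qpoch // [X in _ = _ * X]mulrC.
Qed.
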